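(* Let $A$ be a ring, $T$ a monoid, $\alpha:T\to\mathrm{Endr}(A)$ a monoid homomorphism, and $S\subseteq T$ a left saturated submonoid satisfying the left denominator conditions. Then the ring $R=S^{\mathrm{op}}*_\alpha A*_\alpha T$ has an $S^{-1}T$-grading $R=\bigoplus_{x\in S^{-1}T}R_x$, where for each $x\in S^{-1}T$, $$R_x=\bigcup_{\substack{s\in S,\ t\in T\\ s^{-1}t=x}} s_-\phi(A)t_+ .$$
   Context: All rings are unital. $\mathrm{Endr}(A)$ is the monoid (under composition) of not necessarily unital ring endomorphisms of $A$. Write $\alpha_t=\alpha(t)$ and $p_t=\alpha_t(1)$, an idempotent of $A$, for $t\in T$. The left denominator conditions on $S\subseteq T$: (left Ore) for all $t\in T$, $s\in S$ there exist $s'\in S$, $t'\in T$ with $s't=t's$; (left reversibility) whenever $t,u\in T$ and $ts=us$ for some $s\in S$, there is $s'\in S$ with $s't=s'u$. Under these conditions the monoid of left fractions $S^{-1}T$ exists. $S$ is left saturated in $T$: whenever $s\in S$, $t\in T$ and $ts\in S$, then $t\in S$. Consequently $s_1^{-1}t_1=s_2^{-1}t_2$ in $S^{-1}T$ iff there are $u_1,u_2\in S$ with $u_1s_1=u_2s_2$ and $u_1t_1=u_2t_2$. The ring $R=S^{\mathrm{op}}*_\alpha A*_\alpha T$ is the unital ring equipped with a unital ring homomorphism $\phi:A\to R$ and monoid homomorphisms $s\mapsto s_-$ from $S^{\mathrm{op}}$ to $R$ (so $(su)_-=u_-s_-$, $1_-=1$) and $t\mapsto t_+$ from $T$ to $R$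 (to the multiplicative monoid of $R$), universal with respect to the relations: (1) $t_+\phi(a)=\phi(\alpha_t(a))t_+$ for $a\in A$, $t\in T$; (2) $\phi(a)s_-=s_-\phi(\alpha_s(a))$ for $a\in A$, $s\in S$; (3) $s_-s_+=1$ for $s\in S$; (4) $s_+s_-=\phi(p_s)$ for $s\in S$. (Such a ring exists and is unique up to unique isomorphism.) A grading by a monoid $M$ means a direct sum decomposition into additive subgroups $R_x$, $x\in M$, with $R_xR_y\subseteq R_{xy}$. *)

(* Defs.v *)
From HB Require Import structures.
From mathcomp Require Import all_boot all_algebra.
From mathcomp Require Import boolp classical_sets cardinality fsbigop.

Set Implicit Arguments.
Unset Strict Implicit.
Unset Printing Implicit Defensive.

Import GRing.Theory.
Local Open Scope classical_set_scope.
Local Open Scope ring_scope.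

(* Rings are [pzRingType]s: unital, not necessarily commutative, and possibly
   zero.  The zero ring cannot be excluded: for instance [R] below is zero as
   soon as some [alpha s] with [s \in S] is the zero endomorphism. *)

(* Not necessarily unital ring endomorphisms: [f 1] is only an idempotent. *)
Record endr (A : pzRingType) := Endr {
  endr_fun :> {additive A -> A};
  endrM : {morph endr_fun : a b / a * b}
}.

Section EndrMonoid.
Variable A : pzRingType.
Implicit Types f g h : endr A.

HB.instance Definition _ := gen_eqMixin (endr A).
HB.instance Definition _ := gen_choiceMixin (endr A).

Lemma endrP f g : f =1 g -> f = g.
Proof.
case: f g => [f fM] [g gM] /= fg.
have {}fg : f = g.
  case: f g fg {fM gM} => [f [[fD]]] [g [[gD]]] /= /funext fg.
  by subst g; rewrite (Prop_irrelevance fD gD).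
by subst g; rewrite (Prop_irrelevance fM gM).
Qed.

Fact endr_one_morph : {morph (idfun : A -> A) : a b / a * b}.
Proof. by []. Qed.
Definition endr_one : endr A := @Endr A idfun endr_one_morph.

Fact endr_comp_morph f g : {morph (f \o g) : a b / a * b}.
Proof. by move=> a b /=; rewrite !endrM. Qed.
Definition endr_comp f g : endr A := @Endr A (f \o g) (endr_comp_morph f g).

Fact endr_compA : associative endr_comp.
Proof. by move=> f g h; apply: endrP. Qed.
Fact endr_comp1 : left_id endr_one endr_comp.
Proof. by move=> f; apply: endrP. Qed.
Fact endr_compf1 : right_id endr_one endr_comp.
Proof. by move=> f; apply: endrP. Qed.

HB.instance Definition _ :=
  isMonoid.Build (endr A) endr_compA endr_comp1 endr_compf1.
End EndrMonoid.

Notation "{ 'monoid_morphism' M -> N }" := (UMagmaMorphism.type M%type N%type)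
  (at level 0, M at level 98, N at level 99,
   format "{ 'monoid_morphism'  M  ->  N }") : type_scope.

(* A submonoid of [T] is a predicate [S : umagmaClosed T]; [submonoid S] is the
   monoid of its elements. *)
Section Submonoid.
Variables (T : monoidType) (S : umagmaClosed T).

Record submonoid := Submonoid {
  submonoid_val : T;
  submonoid_valP : submonoid_val \in S
}.

HB.instance Definition _ := [isSub for submonoid_val].
HB.instance Definition _ := [Choice of submonoid by <:].

Fact submonoid_closed : monoid_closed (fun t : T => t \in S).
Proof. by split=> [|s u]; [exact: gpred1 | exact: gpredM]. Qed.
HB.instance Definition _ :=
  SubChoice_isSubMonoid.Build T (fun t : T => t \in S) submonoid
    submonoid_closed.
End Submonoid.

Section Fractions.
Variables (T : monoidType) (S : umagmaClosed T).
Local Open Scope group_scope.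

Definition left_ore : Prop :=
  forall (t : T) (s : submonoid S),
    exists (s' : submonoid S) (t' : T), val s' * t = t' * val s.

Definition left_reversible : Prop :=
  forall (t u : T) (s : submonoid S), t * val s = u * val s ->
    exists s' : submonoid S, val s' * t = val s' * u.

Definition left_denominator : Prop := left_ore /\ left_reversible.

Definition left_saturated : Prop :=
  forall s t : T, s \in S -> t * s \in S -> t \in S.

(* For a morphism [j : T -> Q] : [x] is the left fraction [(j s)^-1 * j t],
   where [v] is the two-sided inverse of [j s]. *)
Definition left_fraction (Q : monoidType) (j : {monoid_morphism T -> Q})
    (s : submonoid S) (t : T) (x : Q) : Prop :=
  exists v : Q, [/\ j (val s) * v = 1, v * j (val s) = 1 & x = v * j t].

(* [Q], with the canonical map [j], is the monoid of left fractions [S^-1 T]: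
   [S] becomes invertible, every element is a left fraction, and [j] identifies
   no more elements than forced by the invertibility of [S].  This determines
   [(Q, j)] up to a unique isomorphism, and such a [(Q, j)] exists exactly when
   [left_denominator] holds. *)
Definition is_left_fractions (Q : monoidType) (j : {monoid_morphism T -> Q}) :
    Prop :=
  [/\ forall s : submonoid S,
        exists v : Q, j (val s) * v = 1 /\ v * j (val s) = 1,
      forall x : Q, exists (s : submonoid S) (t : T), left_fraction j s t x
    & forall t u : T,
        j t = j u <-> exists s : submonoid S, val s * t = val s * u].
End Fractions.

Section FractionalSkewMonoidRing.
Variables (A : pzRingType) (T : monoidType) (S : umagmaClosed T).
Variable alpha : {monoid_morphism T -> endr A}.

(* A ring [R] with maps [phi : A -> R], [s |-> s_-] and [t |-> t_+] satisfying
   the defining relations of [S^op *_alpha A *_alpha T]. *)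
Record skew_maps (R : pzRingType) := SkewMaps {
  phi : {rmorphism A -> R};
  minus : submonoid S -> R;
  plus : T -> R;
  minus1 : minus 1%g = 1;
  minusM : forall s u, minus (s * u)%g = minus u * minus s;
  plus1 : plus 1%g = 1;
  plusM : forall t u, plus (t * u)%g = plus t * plus u;
  plus_phi : forall t a, plus t * phi a = phi (alpha t a) * plus t;
  phi_minus : forall s a, phi a * minus s = minus s * phi (alpha (val s) a);
  minus_plus : forall s, minus s * plus (val s) = 1;
  plus_minus : forall s, plus (val s) * minus s = phi (alpha (val s) 1)
}.

Definition skew_compatible (R B : pzRingType) (D : skew_maps R)
    (E : skew_maps B) (f : {rmorphism R -> B}) : Prop :=
  [/\ forall a, f (phi D a) = phi E a,
      forall s, f (minus D s) = minus E s
    & forall t, f (plus D t) = plus E t].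

(* [R] is the ring [S^op *_alpha A *_alpha T]. *)
Definition skew_universal (R : pzRingType) (D : skew_maps R) : Prop :=
  forall (B : pzRingType) (E : skew_maps B),
    exists f : {rmorphism R -> B}, skew_compatible D E f /\
      forall g : {rmorphism R -> B}, skew_compatible D E g -> g =1 f.

Definition fraction_component (R : pzRingType) (D : skew_maps R)
    (Q : monoidType) (j : {monoid_morphism T -> Q}) (x : Q) : set R :=
  \bigcup_(st in [set st : submonoid S * T | left_fraction j st.1 st.2 x])
    [set minus D st.1 * phi D a * plus D st.2 | a in [set: A]].
End FractionalSkewMonoidRing.

Definition additive_subgroup (V : zmodType) (P : set V) : Prop :=
  P 0 /\ forall a b, P a -> P b -> P (a - b).

(* [V] is the internal direct sum of the [P x]: each element is, in a unique
   way, the sum of a finitely supported family of elements of the [P x]. *)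
Definition internal_direct_sum (I : choiceType) (V : zmodType)
    (P : I -> set V) : Prop :=
  forall r : V, exists! f : I -> V,
    [/\ forall x, P x (f x), finite_set [set x | f x != 0]
      & r = \sum_(x \in [set: I]) f x].

Definition is_grading (M : monoidType) (R : pzRingType) (P : M -> set R) :
    Prop :=
  [/\ forall x, additive_subgroup (P x),
      internal_direct_sum P
    & forall x y a b, P x a -> P y b -> P (x * y)%g (a * b)].

(* Main.v *)
(** Directness comes from a coaction R -> R[Q], where Q = S^-1 T and R[Q] is the
    monoid ring: fixing [phi a] and multiplying s_- by the inverse of the class
    of s and t_+ by the class of t respects the defining relations, and sends
    every r in R_x to r x.  In place of R[Q] we use the additive endomorphisms
    of the functions h : Q -> R, on which r x acts by (r x h) z = r h(z x);
    coefficients are read off by applying them to delta functions and evaluating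
    at 1.  That the R_x span R follows from the universal property applied to
    the subring of sums of homogeneous elements. *)

From HB Require Import structures.
Require Import Defs.
From mathcomp Require Import all_boot all_algebra.
From mathcomp Require Import finmap boolp classical_sets functions cardinality.
From mathcomp Require Import fsbigop.

Set Implicit Arguments.
Unset Strict Implicit.
Unset Printing Implicit Defensive.

Import GRing.Theory.
Local Open Scope classical_set_scope.
Local Open Scope ring_scope.

(** * The ring of additive endomorphisms of an abelian group *)

Definition add_end (V : zmodType) : Type := {additive V -> V}.

Section AdditiveEndomorphisms.
Variable V : zmodType.
Implicit Types f g h : add_end V.

Definition add_end_fun f : V -> V := (f : {additive V -> V}).
Coercion add_end_fun : add_end >-> Funclass.

HB.instance Definition _ f := GRing.Additive.on (add_end_fun f).
HB.instance Definition _ := gen_eqMixin (add_end V).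
HB.instance Definition _ := gen_choiceMixin (add_end V).

Lemma add_endP f g : f =1 g -> f = g.
Proof.
case: f g => [f [[fD]]] [g [[gD]]]; rewrite /add_end_fun /= => /funext fg.
by subst g; rewrite (Prop_irrelevance fD gD).
Qed.

Section Make.
Variables (f : V -> V) (fB : zmod_morphism f).
HB.instance Definition _ := GRing.isZmodMorphism.Build V V f fB.
Definition mk_add_end : add_end V := (f : {additive V -> V}).
End Make.

Fact add_end_zero_subproof : zmod_morphism (fun _ : V => 0 : V).
Proof. by move=> x y; rewrite subr0. Qed.
Fact add_end_opp_subproof f : zmod_morphism (fun x => - f x).
Proof. by move=> x y; rewrite raddfB opprB opprK addrC. Qed.
Fact add_end_add_subproof f g : zmod_morphism (fun x => f x + g x).
Proof. by move=> x y; rewrite !raddfB opprD addrACA. Qed.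
Fact add_end_one_subproof : zmod_morphism (fun x : V => x).
Proof. by []. Qed.
Fact add_end_mul_subproof f g : zmod_morphism (fun x => f (g x)).
Proof. by move=> x y; rewrite !raddfB. Qed.

Definition add_end_add f g := mk_add_end (add_end_add_subproof f g).
Definition add_end_mul f g := mk_add_end (add_end_mul_subproof f g).

Fact add_end_addA : associative add_end_add.
Proof. by move=> f g h; apply: add_endP => x; apply: addrA. Qed.
Fact add_end_addC : commutative add_end_add.
Proof. by move=> f g; apply: add_endP => x; apply: addrC. Qed.
Fact add_end_add0 : left_id (mk_add_end add_end_zero_subproof) add_end_add.
Proof. by move=> f; apply: add_endP => x; apply: add0r. Qed.
Fact add_end_addN : left_inverse (mk_add_end add_end_zero_subproof)
  (fun f => mk_add_end (add_end_opp_subproof f)) add_end_add.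
Proof. by move=> f; apply: add_endP => x; apply: addNr. Qed.

HB.instance Definition _ := GRing.isZmodule.Build (add_end V)
  add_end_addA add_end_addC add_end_add0 add_end_addN.

Fact add_end_mulA : associative add_end_mul.
Proof. by move=> f g h; apply: add_endP. Qed.
Fact add_end_mul1 : left_id (mk_add_end add_end_one_subproof) add_end_mul.
Proof. by move=> f; apply: add_endP. Qed.
Fact add_end_mulf1 : right_id (mk_add_end add_end_one_subproof) add_end_mul.
Proof. by move=> f; apply: add_endP. Qed.
Fact add_end_mulDl : left_distributive add_end_mul +%R.
Proof. by move=> f g h; apply: add_endP. Qed.
Fact add_end_mulDr : right_distributive add_end_mul +%R.
Proof. by move=> f g h; apply: add_endP => x; apply: raddfD. Qed.

HB.instance Definition _ := GRing.Zmodule_isPzRing.Build (add_end V)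
  add_end_mulA add_end_mul1 add_end_mulf1 add_end_mulDl add_end_mulDr.

End AdditiveEndomorphisms.

(** * Subrings, and generation of [R] by the images of its structure maps *)

Section Subring.
Variables (R : pzRingType) (P : subringClosed R).

Record subring := Subring { subring_val : R; _ : subring_val \in P }.

HB.instance Definition _ := [isSub for subring_val].
HB.instance Definition _ := [Choice of subring by <:].

Fact subring_subproof : subring_closed (fun r : R => r \in P).
Proof. by split=> [|r s|r s]; [exact: rpred1|exact: rpredB|exact: rpredM]. Qed.
HB.instance Definition _ := GRing.SubChoice_isSubPzRing.Build
  R (fun r : R => r \in P) subring subring_subproof.
End Subring.

Section Generation.
Variables (A : pzRingType) (T : monoidType) (S : umagmaClosed T).
Variable alpha : {monoid_morphism T -> endr A}.
Variables (R : pzRingType) (D : skew_maps S alpha R).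

(** The structure maps corestrict to [P], so universality gives a ring map [f] from [R] to [P]. Both
    [val \o f] and the identity are compatible with [D]; by uniqueness they agree, hence
    [r = val (f r)] lies in [P]. *)
Lemma skew_universal_generated (P : subringClosed R) :
    skew_universal D ->
    (forall a, phi D a \in P) -> (forall s, minus D s \in P) ->
    (forall t, plus D t \in P) ->
  forall r, r \in P.
Proof.
move=> univ phiP minusP plusP r.
pose phi0 a : subring P := Subring (phiP a).
have phiB : zmod_morphism phi0 by move=> a b; apply: val_inj; exact: rmorphB.
have phiM : monoid_morphism phi0.
  by split=> [|a b]; apply: val_inj; [exact: rmorph1 | exact: rmorphM].
pose phi0_add := GRing.isZmodMorphism.Build _ _ phi0 phiB.
pose phi0_mul := GRing.isMonoidMorphism.Build _ _ phi0 phiM.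
pose phi' : {rmorphism A -> subring P} := HB.pack phi0 phi0_add phi0_mul.
have @E : skew_maps S alpha (subring P).
  refine (@SkewMaps _ _ _ _ _ phi' (fun s => Subring (minusP s))
    (fun t => Subring (plusP t)) _ _ _ _ _ _ _ _) => *; apply: val_inj.
  - exact: minus1.
  - exact: minusM.
  - exact: plus1.
  - exact: plusM.
  - exact: plus_phi.
  - exact: phi_minus.
  - exact: minus_plus.
  - exact: plus_minus.
have [f [[fphi fminus fplus] _]] := univ _ E.
have [g [_ gU]] := univ _ D.
have valf : skew_compatible D D (val \o f : {rmorphism R -> R}).
  by split=> u /=; rewrite ?fphi ?fminus ?fplus.
have idD : skew_compatible D D (idfun : {rmorphism R -> R}) by split.
have -> : r = val (f r) := etrans (gU _ idD r) (esym (gU _ valf r)).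
exact: valP.
Qed.
End Generation.

Lemma sum_pick (I : eqType) (V : zmodType) (r : seq I) (f : I -> V) y :
  uniq r -> (y \notin r -> f y = 0) ->
  \sum_(x <- r) (if x == y then f x else 0) = f y.
Proof.
move=> r_uniq; case: (boolP (y \in r)) => [yr _|yr ->//].
  by rewrite (bigD1_seq y) //= eqxx big1 ?addr0 // => x /negPf->.
by rewrite big1_seq // => x /= xr; case: eqP => // xy; rewrite -xy xr in yr.
Qed.

(** * Left fractions and common denominators *)

Section Components.
Variables (A : pzRingType) (T : monoidType) (S : umagmaClosed T).
Variable alpha : {monoid_morphism T -> endr A}.
Variables (Q : monoidType) (j : {monoid_morphism T -> Q}).
Variables (R : pzRingType) (D : skew_maps S alpha R).
Hypotheses (denS : left_denominator S) (satS : left_saturated S).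
Hypothesis fracQ : is_left_fractions S j.

(** Since [j (val s)] is invertible, its inverse can be eliminated; later degree computations are
    then plain equations in [Q]. *)
Lemma left_fraction_mulP (s : submonoid S) t x :
  left_fraction j s t x <-> (j (val s) * x = j t)%g.
Proof.
split=> [[v [sv _ ->]]|sx]; first by rewrite mulgA sv mul1g.
have [/(_ s)[v [sv vs]] _ _] := fracQ.
by exists v; rewrite -sx mulgA vs mul1g.
Qed.

Lemma left_fraction_exists x :
  exists (s : submonoid S) (t : T), (j (val s) * x = j t)%g.
Proof.
have [_ /(_ x)[s [t /left_fraction_mulP]]] := fracQ.
by exists s, t.
Qed.

Lemma submonoid_cancel (s : submonoid S) x y :
  (j (val s) * x = j (val s) * y)%g -> x = y.
Proof.
have [/(_ s)[v [_ vs]] _ _] := fracQ.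
by move=> /(congr1 (fun z => (v * z)%g)); rewrite !mulgA vs !mul1g.
Qed.

Lemma fraction_componentP x r :
  fraction_component D j x r <->
  exists s t a, (j (val s) * x = j t)%g /\ r = minus D s * phi D a * plus D t.
Proof.
split=> [[[s t] /left_fraction_mulP /= sx [a _ <-]]|]; first by exists s, t, a.
by move=> [s [t [a [/left_fraction_mulP sx ->]]]]; exists (s, t) => //; exists a.
Qed.

(** Expanding a fraction by [u]: insert [u_- u_+ = 1] after [s_-] and move [u_+] to the right across
    [phi D a]. *)
Lemma homogeneous_refine (s u : submonoid S) t a :
  minus D s * phi D a * plus D t =
  minus D (u * s)%g * phi D (alpha (val u) a) * plus D (val u * t)%g.
Proof.
rewrite minusM plusM -!mulrA; congr (_ * _).
by rewrite [phi D _ * (_ * _)]mulrA -plus_phi !mulrA minus_plus mul1r.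
Qed.

(** The Ore condition equalizes the denominators, [s' s1 = t' s2]. The numerators [s' t1] and
    [t' t2] then have the same image under [j], so a further factor [w] from [S] makes them
    equal. *)
Lemma left_fraction_common (s1 s2 : submonoid S) t1 t2 x :
    (j (val s1) * x = j t1)%g -> (j (val s2) * x = j t2)%g ->
  exists u1 u2 : submonoid S,
    (u1 * s1 = u2 * s2)%g /\ (val u1 * t1 = val u2 * t2)%g.
Proof.
move=> e1 e2; have [ore _] := denS; have [_ _ jeq] := fracQ.
have [s' [t' st]] := ore (val s1) s2.
(* Left saturation applies because [t' s2 = s' s1] lies in [S]. *)
have t'S : t' \in S.
  apply: (satS (valP s2)); rewrite -st; exact: gpredM (valP s') (valP s1).
have /jeq [w w12] : j (val s' * t1)%g = j (t' * t2)%g.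
  by rewrite !gmulfM -e1 -e2 !mulgA -!(gmulfM (s := j)) st.
exists (w * s')%g, (w * Submonoid t'S)%g; split; last by rewrite /= -!mulgA w12.
by apply: val_inj; rewrite /= -!mulgA st.
Qed.

(** * Closure of the components under differences and products *)

Lemma fraction_component0 x : fraction_component D j x 0.
Proof.
have [s [t sx]] := left_fraction_exists x; apply/fraction_componentP.
by exists s, t, 0; rewrite rmorph0 mulr0 mul0r.
Qed.

(** Once both elements are refined to a common denominator and numerator, only the middle
    coefficients in [A] are subtracted. *)
Lemma fraction_componentB x a b :
  fraction_component D j x a -> fraction_component D j x b ->
  fraction_component D j x (a - b).
Proof.
move=> /fraction_componentP[s1 [t1 [c1 [e1 ->]]]].
move=> /fraction_componentP[s2 [t2 [c2 [e2 ->]]]].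
have [u1 [u2 [us ut]]] := left_fraction_common e1 e2.
apply/fraction_componentP; exists (u1 * s1)%g, (val u1 * t1)%g.
exists (alpha (val u1) c1 - alpha (val u2) c2); split.
  by rewrite /= !gmulfM -mulgA e1.
rewrite (homogeneous_refine s1 u1) (homogeneous_refine s2 u2) us ut.
by rewrite rmorphB mulrBr mulrBl.
Qed.

Lemma fraction_componentD x a b :
  fraction_component D j x a -> fraction_component D j x b ->
  fraction_component D j x (a + b).
Proof.
move=> ax bx; rewrite -[b]opprK; apply: fraction_componentB => //.
rewrite -sub0r; exact: fraction_componentB (fraction_component0 x) bx.
Qed.

(** Brings [t_+ u_-] back to the order minus, [phi], plus: insert [s'_- s'_+ = 1] on the left, then
    use [s'_+ t_+ = t'_+ u_+] and [u_+ u_- = phi (p_u)]. *)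
Lemma plus_minus_ore t (u s' : submonoid S) t' :
    (val s' * t = t' * val u)%g ->
  plus D t * minus D u =
  minus D s' * phi D (alpha t' (alpha (val u) 1)) * plus D t'.
Proof.
move=> st; rewrite -[plus D t]mul1r -(minus_plus D s') -[_ * plus D t]mulrA.
by rewrite -plusM st plusM -!mulrA plus_minus plus_phi.
Qed.

Lemma fraction_componentM x y a b :
  fraction_component D j x a -> fraction_component D j y b ->
  fraction_component D j (x * y)%g (a * b).
Proof.
move=> /fraction_componentP[s [t [c [ex ->]]]].
move=> /fraction_componentP[u [v [d [ey ->]]]].
have [ore _] := denS; have [s' [t' st]] := ore t u.
(* The inner [t_+ u_-] is reordered by [plus_minus_ore]; then [c] crosses [s'_-] and [d] crosses
   [t'_+], which yields the coefficient below. For the degree, [s' s x y = s' t y = t' u y = t' v]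
   in [Q]. *)
apply/fraction_componentP; exists (s' * s)%g, (t' * v)%g.
exists (alpha (val s') c * alpha t' (alpha (val u) 1) * alpha t' d); split.
  rewrite !gmulfM -!mulgA [(j (val s) * _)%g]mulgA ex mulgA.
  by rewrite -[(j (val s') * _)%g]gmulfM st gmulfM -mulgA ey.
rewrite minusM plusM !rmorphM -!mulrA; congr (_ * _).
rewrite [plus D t * _]mulrA (plus_minus_ore st) -!mulrA.
by rewrite [plus D t' * (phi D d * _)]mulrA plus_phi !mulrA phi_minus.
Qed.

Lemma phi_component a : fraction_component D j 1%g (phi D a).
Proof.
apply/fraction_componentP; exists 1%g, 1%g, a; split; first by rewrite mulg1.
by rewrite minus1 plus1 mul1r mulr1.
Qed.

Lemma plus_component t : fraction_component D j (j t) (plus D t).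
Proof.
apply/fraction_componentP; exists 1%g, t, 1.
by rewrite gmulf1 mul1g minus1 rmorph1 !mul1r.
Qed.

Lemma minus_component s x :
  (j (val s) * x = 1)%g -> fraction_component D j x (minus D s).
Proof.
move=> sx; apply/fraction_componentP; exists s, 1%g, 1.
by rewrite gmulf1 plus1 rmorph1 !mulr1.
Qed.

(** * The components span [R] *)

(** Degrees may repeat in the list, so sums are concatenations and products are lists of pairwise
    products; equal degrees are collected only in the proof of directness. *)
Definition homogeneous_sum (r : R) : Prop :=
  exists2 s : seq (Q * R),
    forall p, p \in s -> fraction_component D j p.1 p.2
  & r = \sum_(p <- s) p.2.

Lemma component_homogeneous_sum x r :
  fraction_component D j x r -> homogeneous_sum r.
Proof.
move=> rx; exists [:: (x, r)]; last by rewrite big_seq1.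
by move=> p; rewrite inE => /eqP->.
Qed.

Lemma homogeneous_sumP : subring_closed (fun r => `[< homogeneous_sum r >]).
Proof.
split=> [|r1 r2|r1 r2].
- apply/asboolP/component_homogeneous_sum; rewrite -(rmorph1 (phi D)).
  exact: phi_component.
- move=> /asboolP[s1 s1P ->] /asboolP[s2 s2P ->]; apply/asboolP.
  exists (s1 ++ [seq (p.1, - p.2) | p <- s2]).
    move=> p; rewrite mem_cat => /orP[/s1P //|/mapP[q /s2P qP ->] /=].
    rewrite -sub0r; exact: fraction_componentB (fraction_component0 _) qP.
  by rewrite big_cat big_map sumrN.
- move=> /asboolP[s1 s1P ->] /asboolP[s2 s2P ->]; apply/asboolP.
  exists [seq ((p.1 * q.1)%g, p.2 * q.2) | p <- s1, q <- s2].
    move=> _ /allpairsP[[p q] [/s1P pP /s2P qP ->]].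
    exact: fraction_componentM.
  rewrite big_allpairs_dep mulr_suml; apply: eq_bigr => p _.
  by rewrite mulr_sumr.
Qed.

Hypothesis univ : skew_universal D.

(** Sums of homogeneous elements form a subring, and it contains the generators: [phi D a] has
    degree 1, [s_-] the inverse of [j (val s)], and [t_+] the degree [j t]. *)
Lemma homogeneous_sum_all r : homogeneous_sum r.
Proof.
pose P0 : {pred R} := fun r => `[< homogeneous_sum r >].
pose P_closed := GRing.isSubringClosed.Build R P0 homogeneous_sumP.
pose P : subringClosed R := HB.pack P0 P_closed.
apply/asboolP.
apply: (@skew_universal_generated _ _ _ _ _ _ P univ) => u; apply/asboolP.
- exact: component_homogeneous_sum (phi_component u).
- have [/(_ u)[v [uv _]] _ _] := fracQ.
  exact: component_homogeneous_sum (minus_component uv).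
- exact: component_homogeneous_sum (plus_component u).
Qed.

(** * The coaction *)

Fact shift_subproof (r : R) (x : Q) :
  zmod_morphism (fun (h : Q -> R) z => r * h (z * x)%g).
Proof. by move=> h k; apply/funext => z; apply: mulrBr. Qed.

(* The action of the element [r x] of the monoid ring [R[Q]]. *)
Definition shift r x : add_end (Q -> R) := mk_add_end (shift_subproof r x).

Lemma shiftM r x r' x' : shift r x * shift r' x' = shift (r * r') (x * x')%g.
Proof.
by apply: add_endP => h; apply/funext => z; rewrite /= -mulrA mulgA.
Qed.

Lemma shift1 : shift 1 1%g = 1.
Proof.
by apply: add_endP => h; apply/funext => z; rewrite /= mul1r mulg1.
Qed.

Lemma shiftB r r' x : shift (r - r') x = shift r x - shift r' x.
Proof. by apply: add_endP => h; apply/funext => z; apply: mulrBl. Qed.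

Lemma coaction_exists :
  exists f : {rmorphism R -> add_end (Q -> R)},
    forall x r, fraction_component D j x r -> f r = shift r x.
Proof.
have [jinv _ _] := fracQ; have [v vP] := choice jinv.
pose phi0 a := shift (phi D a) 1%g.
have phiB : zmod_morphism phi0 by move=> a b; rewrite /phi0 rmorphB shiftB.
have phiM : monoid_morphism phi0.
  by split=> [|a b]; rewrite /phi0 ?rmorph1 ?shift1 // shiftM mulg1 rmorphM.
pose phi0_add := GRing.isZmodMorphism.Build _ _ phi0 phiB.
pose phi0_mul := GRing.isMonoidMorphism.Build _ _ phi0 phiM.
pose phi' : {rmorphism A -> add_end (Q -> R)} :=
  HB.pack phi0 phi0_add phi0_mul.
have @E : skew_maps S alpha (add_end (Q -> R)).
  refine (@SkewMaps _ _ _ _ _ phi' (fun s => shift (minus D s) (v s))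
    (fun t => shift (plus D t) (j t)) _ _ _ _ _ _ _ _).
  - rewrite minus1 -shift1; congr (shift _ _).
    by have [+ _] := vP 1%g; rewrite gmulf1 mul1g.
  - move=> s u; rewrite shiftM minusM; congr (shift _ _).
    (* The inverses [v] are chosen separately for each element, so [v (s * u) = v u * v s] is
       obtained by cancelling [j] of the product. *)
    apply: (@submonoid_cancel (s * u)%g); rewrite (vP _).1 /= gmulfM.
    by rewrite -mulgA [(j (val u) * _)%g]mulgA (vP u).1 mul1g (vP s).1.
  - by rewrite plus1 gmulf1 shift1.
  - by move=> t u; rewrite shiftM plusM gmulfM.
  - by move=> t a; rewrite !shiftM plus_phi mulg1 mul1g.
  - by move=> s a; rewrite !shiftM phi_minus mulg1 mul1g.
  - by move=> s; rewrite shiftM minus_plus (vP s).2 shift1.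
  - by move=> s; rewrite shiftM plus_minus (vP s).1.
have [f [[fphi fminus fplus] _]] := univ E.
exists f => x r /fraction_componentP[s [t [a [sx ->]]]].
(* The three factors of [r] have degrees [v s], 1 and [j t]; their product is [x] because
   [j (val s) * x = j t]. *)
rewrite !rmorphM fphi fminus fplus /= !shiftM mulg1; congr (shift _ _).
by apply: (@submonoid_cancel s); rewrite mulgA (vP s).1 mul1g sx.
Qed.

(** * Coefficients and directness of the sum *)

Lemma coefficient_exists :
  exists c : Q -> {additive R -> R}, forall x r, fraction_component D j x r ->
    forall y, c y r = if x == y then r else 0.
Proof.
have [f fP] := coaction_exists.
(* For [r] of degree [x] this is [r] times the delta function at [y] evaluated at [1 * x]. *)
pose c y r := f r (fun z => (z == y)%:R) 1%g.
have cB y : zmod_morphism (c y) by move=> r s; rewrite /c rmorphB.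
pose ca y := GRing.isZmodMorphism.Build _ _ (c y) (cB y).
exists (fun y => HB.pack_for {additive R -> R} (c y) (ca y)) => x r rx y /=.
by rewrite /c (fP x) //= mul1g; case: eqP => _; rewrite ?mulr1 ?mulr0.
Qed.

(** This gives uniqueness of decompositions. Finite support turns the sum into one over a list,
    through which the additive [c y] passes, keeping only the term of degree [y]. *)
Lemma fsum_coefficient (c : Q -> {additive R -> R}) (f : Q -> R) :
    (forall x r, fraction_component D j x r ->
      forall y, c y r = if x == y then r else 0) ->
    (forall x, fraction_component D j x (f x)) ->
    finite_set [set x | f x != 0] ->
  forall y, c y (\sum_(x \in [set: Q]) f x) = f y.
Proof.
move=> cP fP ffin y.
have f0 x : x \notin fset_set [set x | f x != 0] -> f x = 0.
  by rewrite in_fset_set // notin_setE /= => /negP; rewrite negbK => /eqP.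
rewrite (fsbigTE _ _ f0) raddf_sum; under eq_bigr do rewrite (cP _ _ (fP _)).
by rewrite sum_pick //; apply: f0.
Qed.

Lemma fraction_component_direct :
  internal_direct_sum (fraction_component D j).
Proof.
have [c cP] := coefficient_exists => r.
have [s sP r_sum] := homogeneous_sum_all r.
have cE y : c y r = \sum_(p <- s) (if p.1 == y then p.2 else 0).
  by rewrite r_sum raddf_sum; apply: eq_big_seq => p /sP/cP.
(* The support is bounded by the finitely many degrees that occur in [s]. *)
have c0 y : y \notin undup [seq p.1 | p <- s] -> c y r = 0.
  rewrite mem_undup cE => ys; rewrite big1_seq // => p /= ps.
  by case: eqP => // py; case/negP: ys; rewrite -py map_f.
exists (fun y => c y r); split=> [|f [fP ffin ->]]; last first.
  by apply/funext => y; apply: fsum_coefficient.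
split.
- move=> y; rewrite cE big_seq_cond.
  elim/big_rec: _ => [|p a /andP[/sP pP _] ya].
    exact: fraction_component0.
  apply: fraction_componentD => //; case: eqP => [<- //|_].
  exact: fraction_component0.
- apply: (@sub_finite_set _ _ [set` undup [seq p.1 | p <- s]]) => // y /=.
  by apply: contraR => /c0 ->.
(* [undup] lists each degree once, so after the two sums are exchanged every [p] in [s] contributes
   [p.2] exactly once, at [y = p.1]. *)
- rewrite (fsbigE (undup [seq p.1 | p <- s])) ?undup_uniq //; last first.
    by move=> y _; apply: c0.
  under eq_bigl do rewrite in_setT.
  under eq_bigr do rewrite cE; rewrite exchange_big /= r_sum.
  apply: eq_big_seq => p ps.
  under eq_bigr do rewrite eq_sym.
  rewrite (sum_pick (f := fun=> p.2)) ?undup_uniq // mem_undup.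
  by rewrite map_f.
Qed.

End Components.

Theorem proposition1p7 (A : pzRingType) (T : monoidType)
    (alpha : {monoid_morphism T -> endr A}) (S : umagmaClosed T)
    (denS : left_denominator S) (satS : left_saturated S)
    (Q : monoidType) (j : {monoid_morphism T -> Q})
    (fracQ : is_left_fractions S j)
    (R : pzRingType) (D : skew_maps S alpha R) (univR : skew_universal D) :
  is_grading (fraction_component D j).
Proof.
split=> [x||x y a b].
- split; first exact: fraction_component0.
  by move=> a b; apply: fraction_componentB.
- exact: fraction_component_direct.
- exact: fraction_componentM.
Qed.
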